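(* Let $0<q<1$, let $B$ be a unital associative $\mathbb C$-algebra, and let $a\in B$, viewed as a constant function of $t$. Then the following identities hold in $B[[t]]$: a) $$\exp\big(\Omega_q(a)(t)\big)=E_q(at)\qquad\text{and}\qquad \exp\big(-\Omega_q(-a)(t)\big)=e_q(at).$$ b) $$\Omega_q(a)(t)=\sum_{n>0}\frac{(q-1)^{n-1}}{[n]_q}\frac{t^n}{n}a^n,$$ $$\Omega'_q(a)(t)=\sum_{n>0}(q-1)^{n-1}\frac{t^{n-1}}{n}a^n=-\frac{1}{(q-1)t}\log\big(1-at(q-1)\big).$$
   Context: Here $t$ is a variable commuting with $B$, and $\exp$ and $\log$ are the ordinary exponential and logarithm power series. $q$-numbers: $[n]_q:=\frac{1-q^n}{1-q}$, $[0]_q!:=1$, $[n]_q!:=\prod_{i=1}^n[i]_q$. $q$-exponentials: $e_q(x):=\sum_{n\ge0}\frac{x^n}{[n]_q!}$ and $E_q(x):=\sum_{n\ge0}q^{n(n-1)/2}\frac{x^n}{[n]_q!}$. Jackson's $q$-integral is $I_qf(t):=(1-q)\sum_{k\ge0}q^kt\,f(q^kt)$; on power series it is given coefficientwise by $I_q(bt^k)=b\,\frac{t^{k+1}}{[k+1]_q}$ for $b\in B$. The $q$-dilation is $M_qf(t):=f(qt)$. The left pre-Lie product $\rhd_q$ on functions (power series in $t$ with coefficients in $B$) is $$f\rhd_q g:=I_q(f)\,g-g\,M_qI_q(f).$$ Write $L_{\rhd_q}(f)(g):=f\rhd_qg$ and $$W_q(f):=\sum_{n\ge0}\frac{1}{(n+1)!}L_{\rhd_q}(f)^n(f)=f+\tfrac12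 f\rhd_qf+\tfrac16 f\rhd_q(f\rhd_qf)+\cdots.$$ The map $W_q:B[[t]]\to B[[t]]$ is a bijection (note that $\rhd_q$ raises the total $t$-degree by one), and $\Omega'_q:=W_q^{-1}$; equivalently $\Omega'_q(f)$ is the solution of $\Omega'_q(f)=\sum_{m\ge0}\frac{B_m}{m!}L_{\rhd_q}(\Omega'_q(f))^m(f)$, with $B_m$ the Bernoulli numbers ($\frac{z}{e^z-1}=\sum_m\frac{B_m}{m!}z^m$). Finally $\Omega_q(f):=I_q(\Omega'_q(f))$. *)

(* Defs.v *)
From HB Require Import structures.
From mathcomp Require Import all_boot all_order all_algebra.
From mathcomp Require Import boolp classical_sets reals complex.

Set Implicit Arguments.
Unset Strict Implicit.
Unset Printing Implicit Defensive.

Import GRing.Theory.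
Local Open Scope ring_scope.

(* B[[t]]: the coefficient of t^n of f is f n.  A wrapper around nat -> B keeps
   the Cauchy product apart from the pointwise product of functions. *)
Record fps (B : Type) := FPS { coefs :> nat -> B }.

HB.instance Definition _ (B : Type) := gen_eqMixin (fps B).
HB.instance Definition _ (B : Type) := gen_choiceMixin (fps B).

Lemma fpsP (B : Type) (f g : fps B) : (forall n, f n = g n) -> f = g.
Proof. by case: f g => [f] [g] /= fg; congr FPS; apply/funext. Qed.

Section Ring.
Variable B : nzRingType.
Implicit Types f g h : fps B.

Definition fps_zero : fps B := FPS (fun=> 0).
Definition fps_opp f := FPS (fun n => - f n).
Definition fps_add f g := FPS (fun n => f n + g n).
Definition fpsC (b : B) : fps B := FPS (fun n => if n == 0%N then b else 0).
Definition fps_mul f g := FPS (fun n => \sum_(i < n.+1) f i * g (n - i)%N).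

Fact fps_addA : associative fps_add.
Proof. by move=> f g h; apply: fpsP => n /=; rewrite addrA. Qed.
Fact fps_addC : commutative fps_add.
Proof. by move=> f g; apply: fpsP => n /=; rewrite addrC. Qed.
Fact fps_add0 : left_id fps_zero fps_add.
Proof. by move=> f; apply: fpsP => n /=; rewrite add0r. Qed.
Fact fps_addN : left_inverse fps_zero fps_opp fps_add.
Proof. by move=> f; apply: fpsP => n /=; rewrite addNr. Qed.

HB.instance Definition _ :=
  GRing.isZmodule.Build (fps B) fps_addA fps_addC fps_add0 fps_addN.

Fact fps_mulA : associative fps_mul.
Proof.
move=> f g h; apply: fpsP => n /=.
have tr (u : fps B) m : (m <= n)%N -> u m = (\poly_(i < n.+1) u i)`_m.
  by move=> mn; rewrite coef_poly ltnS mn.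
pose P (u : fps B) : {poly B} := \poly_(i < n.+1) u i.
have PM (u v : fps B) m : (m <= n)%N -> (P u * P v)`_m = fps_mul u v m.
  move=> mn; rewrite coefM; apply: eq_bigr => i _.
  by rewrite -!tr // ?(leq_trans (leq_subr _ _)) // (leq_trans _ mn) // -ltnS.
transitivity ((P f * (P g * P h))`_n); last rewrite mulrA.
  rewrite coefM; apply: eq_bigr => i _.
  by rewrite -tr -1?ltnS // PM // leq_subr.
rewrite coefM; apply: eq_bigr => i _.
by rewrite -tr ?leq_subr // PM // -ltnS.
Qed.

Fact fps_mul1 : left_id (fpsC 1) fps_mul.
Proof.
move=> f; apply: fpsP => n /=; rewrite big_ord_recl /= mul1r subn0.
by rewrite big1 ?addr0 // => i _; rewrite mul0r.
Qed.
Fact fps_mulr1 : right_id (fpsC 1) fps_mul.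
Proof.
move=> f; apply: fpsP => n /=; rewrite big_ord_recr /= subnn mulr1.
by rewrite big1 ?add0r // => i _; rewrite subn_eq0 leqNgt ltn_ord mulr0.
Qed.
Fact fps_mulDl : left_distributive fps_mul fps_add.
Proof.
move=> f g h; apply: fpsP => n /=; rewrite -big_split /=.
by apply: eq_bigr => i _; rewrite mulrDl.
Qed.
Fact fps_mulDr : right_distributive fps_mul fps_add.
Proof.
move=> f g h; apply: fpsP => n /=; rewrite -big_split /=.
by apply: eq_bigr => i _; rewrite mulrDr.
Qed.
Fact fps_1neq0 : fpsC 1 != 0.
Proof.
by apply/eqP => /(congr1 (fun f : fps B => f 0%N)) /eqP; rewrite oner_eq0.
Qed.

HB.instance Definition _ :=
  GRing.Zmodule_isNzRing.Build (fps B)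
    fps_mulA fps_mul1 fps_mulr1 fps_mulDl fps_mulDr fps_1neq0.

Definition fpsT : fps B := FPS (fun n => (n == 1%N)%:R).

(* Division by t, for series without constant term. *)
Definition fps_divT f : fps B := FPS (fun n => f n.+1).

Lemma fps_divTK f : f 0%N = 0 -> fpsT * fps_divT f = f.
Proof.
move=> f0; apply: fpsP => -[|n]; rewrite /= /fps_mul big_ord_recl /= mul0r add0r.
  by rewrite big_ord0.
rewrite big_ord_recl /= mul1r big1 ?addr0 => [|i _]; last by rewrite mul0r.
by rewrite /bump /= subSS subn0.
Qed.

(* The sum over k >= m of u k, for the t-adic topology: every coefficient of
   the partial sums is eventually constant, and its eventual value is the
   coefficient of the sum (0 if a coefficient does not stabilize). *)
Definition fps_series (m : nat) (u : nat -> fps B) : fps B :=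
  FPS (fun n => xget 0 [set s : B |
    exists N, forall M, (N <= M)%N -> \sum_(m <= k < M) u k n = s]).

Lemma fps_seriesE m (u : nat -> fps B) N n : (forall k, (N <= k)%N -> u k n = 0) ->
  fps_series m u n = \sum_(m <= k < N) u k n.
Proof.
move=> u0.
have st M : (N <= M)%N -> \sum_(m <= k < M) u k n = \sum_(m <= k < N) u k n.
  move=> NM; case: (ltnP m N) => mN.
    rewrite (big_cat_nat (ltnW mN) NM) /= [X in _ + X]big_nat_cond.
    rewrite [X in _ + X]big1 ?addr0 //.
    by move=> k /andP[/andP[Nk _] _]; exact: u0.
  rewrite [RHS]big_geq // big_nat_cond big1 // => k.
  by move=> /andP[/andP[mk _] _]; apply: u0; rewrite (leq_trans mN).
apply: xget_unique => [|s [N' s_]]; first by exists N.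
by rewrite -(s_ (maxn N N')) ?leq_maxr // st ?leq_maxl.
Qed.

End Ring.

Arguments fpsT {B}.

Section Algebra.
Variables (F : fieldType) (B : algType F).
Implicit Types f g : fps B.

Definition fps_scale (c : F) f := FPS (fun n => c *: f n).

Fact fps_scaleA c d f : fps_scale c (fps_scale d f) = fps_scale (c * d) f.
Proof. by apply: fpsP => n /=; rewrite scalerA. Qed.
Fact fps_scale1 : left_id 1 fps_scale.
Proof. by move=> f; apply: fpsP => n /=; rewrite scale1r. Qed.
Fact fps_scaleDr : right_distributive fps_scale +%R.
Proof. by move=> c f g; apply: fpsP => n /=; rewrite scalerDr. Qed.
Fact fps_scaleDl f : {morph fps_scale^~ f : c d / c + d}.
Proof. by move=> c d; apply: fpsP => n /=; rewrite scalerDl. Qed.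

HB.instance Definition _ :=
  GRing.Zmodule_isLmodule.Build F (fps B)
    fps_scaleA fps_scale1 fps_scaleDr fps_scaleDl.

Fact fps_scaleAl (c : F) f g : c *: (f * g) = c *: f * g.
Proof.
apply: fpsP => n /=; rewrite scaler_sumr.
by apply: eq_bigr => i _; rewrite scalerAl.
Qed.
HB.instance Definition _ :=
  GRing.Lmodule_isLalgebra.Build F (fps B) fps_scaleAl.

Fact fps_scaleAr (c : F) f g : c *: (f * g) = f * (c *: g).
Proof.
apply: fpsP => n /=; rewrite scaler_sumr.
by apply: eq_bigr => i _; rewrite scalerAr.
Qed.
HB.instance Definition _ :=
  GRing.Lalgebra_isAlgebra.Build F (fps B) fps_scaleAr.

(* fps_exp is the exponential for series without constant term, fps_log the
   logarithm for series with constant term 1. *)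
Definition fps_exp f : fps B :=
  fps_series 0 (fun n => (n`!%:R)^-1 *: f ^+ n).

Definition fps_log f : fps B :=
  fps_series 1 (fun n => ((-1) ^+ n.-1 / n%:R) *: (f - 1) ^+ n).

Variable q : F.

Definition qnum (n : nat) : F := (1 - q ^+ n) / (1 - q).

Definition qfact (n : nat) : F := \prod_(1 <= i < n.+1) qnum i.

Definition qexp f : fps B :=
  fps_series 0 (fun n => (qfact n)^-1 *: f ^+ n).

Definition qExp f : fps B :=
  fps_series 0 (fun n => (q ^+ (n * n.-1)./2 / qfact n) *: f ^+ n).

(* Jackson's integral (1 - q) \sum_(k >= 0) q^k t f(q^k t): summing the
   geometric series in q^(n+1) maps b t^n to b t^(n+1) / [n+1]_q. *)
Definition qint f : fps B :=
  FPS (fun n => if n is k.+1 then (qnum k.+1)^-1 *: f k else 0).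

Definition qdil f : fps B := FPS (fun n => q ^+ n *: f n).

Definition qprelie f g : fps B := qint f * g - g * qdil (qint f).

Definition Wq f : fps B :=
  fps_series 0 (fun n => ((n.+1)`!%:R)^-1 *: iter n (qprelie f) f).

(* The inverse of the bijection Wq, see Wq_bij and Omega'qK below. *)
Definition Omega'q f : fps B := xget 0 [set g : fps B | Wq g = f].

Definition Omegaq f : fps B := qint (Omega'q f).

Let qdilE f n : qdil f n = q ^+ n *: f n. Proof. by []. Qed.

Let agree n f g := forall i, (i < n)%N -> f i = g i.

Let agree_prelie n f f' g g' : agree n f f' -> agree n g g' ->
  agree n.+1 (qprelie f g) (qprelie f' g').
Proof.
move=> ff gg i; rewrite ltnS => i_n.
have qq k : (k <= i)%N -> qint f k = qint f' k.
  by case: k => //= k ki; rewrite ff // (leq_trans ki).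
congr (_ - _).
- apply: eq_bigr => -[k ki] _; rewrite [nat_of_ord _]/=; rewrite ltnS in ki.
  rewrite qq //; case: (posnP k) => [->|k0]; first by rewrite !mul0r.
  by rewrite gg // (leq_trans _ i_n) // ltn_subrL k0 (leq_trans k0).
- apply: eq_bigr => -[k ki] _; rewrite [nat_of_ord _]/=; rewrite ltnS in ki.
  rewrite !qdilE qq ?leq_subr //.
  case: (ltnP k i) => [k_i|i_k]; first by rewrite gg ?(leq_trans k_i).
  by rewrite (_ : i - k = 0)%N /= ?scaler0 ?mulr0 //; apply/eqP; rewrite subn_eq0.
Qed.

Let qprelie0 f : qprelie f 0 = 0.
Proof. by rewrite /qprelie mulr0 mul0r subr0. Qed.

Let iter_prelie_ord f k : agree k (iter k (qprelie f) f) 0.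
Proof.
elim: k => // k IHk; rewrite iterS -(qprelie0 f).
exact: agree_prelie.
Qed.

Lemma WqE f n : Wq f n =
  \sum_(0 <= k < n.+1) ((k.+1)`!%:R)^-1 *: iter k (qprelie f) f n.
Proof.
apply: fps_seriesE => k nk.
have /= -> := iter_prelie_ord f nk.
exact: scaler0.
Qed.

Let Wq_rem n f g : agree n f g -> Wq f n - f n = Wq g n - g n.
Proof.
move=> fg; rewrite !WqE !big_nat_recl //= invr1 !scale1r.
rewrite ![_ + \sum_(_ <= _ < _) _]addrC.
rewrite !addrK; apply: eq_bigr => k _; congr (_ *: _).
have : agree n (iter k (qprelie f) f) (iter k (qprelie g) g).
  by elim: k => // k IHk i i_n /=; apply: (agree_prelie fg IHk); rewrite leqW.
by move/(agree_prelie fg); apply.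
Qed.

Let Wq_inj : injective Wq.
Proof.
move=> f g fg; apply: fpsP => n; elim/ltn_ind: n => n IHn.
by have := Wq_rem IHn; rewrite fg => /addrI/oppr_inj.
Qed.

Let Wq_surj f : exists g, Wq g = f.
Proof.
pose G := fix G k : fps B :=
  if k is k'.+1 then FPS (fun n => f n - (Wq (G k') n - G k' n)) else 0.
have GS k : agree k (G k) (G k.+1).
  elim: k => // k IHk i; rewrite ltnS => ik; rewrite [LHS]/= [RHS]/=.
  congr (_ - _); apply: Wq_rem => j ji; apply: IHk; exact: leq_trans ji ik.
have Gle k l : (k <= l)%N -> agree k (G k) (G l).
  move=> /subnK <-; elim: (l - k)%N => // d IHd i ik.
  by rewrite IHd // addSn GS // (leq_trans ik) // leq_addl.
exists (FPS (fun n => G n.+1 n)); apply: fpsP => n.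
set g := FPS _.
have gG : agree n g (G n) by move=> i i_n; apply: Gle.
by rewrite -[LHS](subrK (g n)) (Wq_rem gG) /= addrC subrK.
Qed.

Lemma Omega'qK : cancel Omega'q Wq.
Proof. by move=> f; exact: (@xgetPex _ 0 [set g | Wq g = f] (Wq_surj f)). Qed.

Lemma Wq_bij : bijective Wq.
Proof. by exists Omega'q => [f|]; [apply: Wq_inj|]; exact: Omega'qK. Qed.

End Algebra.

(* Main.v *)
(* Write Omega = I_q(omega) with omega = Omega'_q(a). In the commutative case
   I_q f - M_q I_q f = (1 - q) t f, hence f |>_q g = (1 - q) t f g and
   (1 - q) t W_q(f) = exp((1 - q) t f) - 1. So W_q(omega) = a means
   exp((1 - q) t omega) = 1 + (1 - q) a t, which gives omega as a logarithm, and
   Omega = (1 - q) t omega + M_q Omega becomes, on exponentials,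
   exp(Omega)(t) = (1 + (1 - q) a t) exp(Omega)(q t), the q-difference equation
   of E_q(a t); exp(-Omega) satisfies the inverse one. For general B, all the
   series involved are images of scalar ones (the case a = 1) under the
   substitution t -> a t; as omega has a^(n+1) in front of t^n, it is such an
   image times a. *)

Require Import Defs.
From mathcomp Require Import all_boot all_order all_algebra.
From mathcomp Require Import reals complex.

Set Implicit Arguments.
Unset Strict Implicit.
Unset Printing Implicit Defensive.

Import GRing.Theory.
Local Open Scope ring_scope.
Local Open Scope complex_scope.

(** * Coefficients of power series, and the formal derivative *)

Section Ring.
Variable B : nzRingType.
Implicit Types (b : B) (f g h : fps B).

Lemma fps_coefD f g n : (f + g) n = f n + g n. Proof. by []. Qed.

Lemma fps_coefN f n : (- f) n = - f n. Proof. by []. Qed.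

Lemma fps_coefM f g n : (f * g) n = \sum_(i < n.+1) f i * g (n - i)%N.
Proof. by []. Qed.

Lemma fps_coefM0 f g : (f * g) 0%N = f 0%N * g 0%N.
Proof. by rewrite fps_coefM big_ord1. Qed.

Lemma fps_coef1 n : (1 : fps B) n = (n == 0%N)%:R.
Proof. by case: n. Qed.

Lemma fps_coef_sum m n (u : nat -> fps B) i :
  (\sum_(m <= k < n) u k) i = \sum_(m <= k < n) u k i.
Proof. by elim/big_rec2: _ => // k x y _ <-. Qed.

Lemma fps_coefCM b f n : (fpsC b * f) n = b * f n.
Proof.
rewrite fps_coefM big_ord_recl subn0 big1 ?addr0 // => i _.
by rewrite mul0r.
Qed.

Lemma fps_coefMC b f n : (f * fpsC b) n = f n * b.
Proof.
rewrite fps_coefM big_ord_recr /= subnn big1 ?add0r // => i _.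
by rewrite subn_eq0 leqNgt ltn_ord mulr0.
Qed.

Lemma fps_coefTM f n : (fpsT * f) n.+1 = f n.
Proof.
rewrite fps_coefM big_ord_recl /= mul0r add0r big_ord_recl /= mul1r.
rewrite big1 ?addr0 => [|i _]; last by rewrite mul0r.
by rewrite /bump /= subSS subn0.
Qed.

Lemma fps_coefTM0 f : (fpsT * f) 0%N = 0.
Proof. by rewrite fps_coefM0 mul0r. Qed.

Lemma fps_coefTX k n : ((fpsT : fps B) ^+ k) n = (n == k)%:R.
Proof.
elim: k n => [|k IHk] [|n]; rewrite ?expr0 ?fps_coef1 // exprS.
  by rewrite fps_coefTM0.
by rewrite fps_coefTM IHk.
Qed.

Lemma fpsCT_comm b : GRing.comm (fpsC b) (fpsT : fps B).
Proof.
apply: fpsP => -[|n]; rewrite fps_coefCM ?fps_coefTM0 ?fps_coefTM.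
  by rewrite mulr0.
by case: n => [|n]; rewrite ?mulr1 ?mulr0.
Qed.

Lemma fpsCX b k : fpsC b ^+ k = fpsC (b ^+ k).
Proof.
elim: k => [|k IHk]; rewrite ?expr0 // !exprS IHk; apply: fpsP => n.
by rewrite fps_coefCM /=; case: ifP => // _; rewrite mulr0.
Qed.

(** This makes a power series in [f] a finite sum in each degree. *)
Lemma fps_coefX_lt f k n : f 0%N = 0 -> (n < k)%N -> (f ^+ k) n = 0.
Proof.
move=> f0; elim: k n => // k IHk n nk.
rewrite exprS fps_coefM big_ord_recl f0 mul0r add0r big1 // => i _.
rewrite IHk ?mulr0 //= /bump /= add1n.
have := ltn_ord i; move: nk; case: n i => [|n] i; first by case: i.
by rewrite subSS !ltnS => nk _; apply: leq_ltn_trans (leq_subr _ _) nk.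
Qed.

Lemma fps_coefM_eqr f g h n :
  (forall i, (i <= n)%N -> g i = h i) -> (f * g) n = (f * h) n.
Proof. by move=> gh; apply: eq_bigr => i _; rewrite gh // leq_subr. Qed.

Lemma fps_series_single m (u : nat -> fps B) n k : (m <= k)%N ->
  (forall j, j != k -> u j n = 0) -> fps_series m u n = u k n.
Proof.
move=> mk u0; rewrite (@fps_seriesE _ _ _ k.+1) => [|j kj]; last first.
  by rewrite u0 // neq_ltn kj orbT.
rewrite big_nat_recr //= big_nat_cond big1 ?add0r // => j.
by case/andP=> /andP[_ jk] _; rewrite u0 // neq_ltn jk.
Qed.

Definition fps_deriv f : fps B := FPS (fun n => f n.+1 *+ n.+1).

Lemma fps_derivD f g : fps_deriv (f + g) = fps_deriv f + fps_deriv g.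
Proof. by apply: fpsP => n /=; rewrite mulrnDl. Qed.

Lemma fps_derivM f g :
  fps_deriv (f * g) = fps_deriv f * g + f * fps_deriv g.
Proof.
apply: fpsP => n; rewrite fps_coefD /= /fps_mul -sumrMnl.
transitivity (\sum_(i < n.+2) (f i *+ i) * g (n.+1 - i)%N +
              \sum_(i < n.+2) f i * (g (n.+1 - i)%N *+ (n.+1 - i))).
  rewrite -big_split; apply: eq_bigr => i _ /=.
  by rewrite mulrnAl mulrnAr -mulrnDr subnKC // -ltnS.
congr (_ + _).
  by rewrite big_ord_recl mulr0n mul0r add0r.
rewrite big_ord_recr /= subnn mulr0n mulr0 addr0; apply: eq_bigr => i _ /=.
by rewrite subSn // -ltnS.
Qed.

End Ring.

(** * Derivatives of powers over a commutative ring *)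

Section Commutative.
Variable B : nzRingType.
Hypothesis mulBC : commutative (@GRing.mul B).
Implicit Types f g : fps B.

Lemma fps_mulC : commutative (@GRing.mul (fps B)).
Proof.
move=> f g; apply: fpsP => n; rewrite !fps_coefM (reindex_inj rev_ord_inj) /=.
by apply: eq_bigr => i _; rewrite subSS subKn 1?mulBC // -ltnS.
Qed.

Lemma fps_derivX f k :
  fps_deriv (f ^+ k.+1) = (fps_deriv f * f ^+ k) *+ k.+1.
Proof.
elim: k => [|k IHk]; first by rewrite expr1 expr0 mulr1.
rewrite exprS fps_derivM IHk mulrnAr [in RHS]mulrS; congr (_ + _ *+ _).
by rewrite mulrA [f * _]fps_mulC -mulrA -exprS.
Qed.

End Commutative.

(** * Power series in a series without constant term; [q]-integral and [q]-dilation *)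

Section Algebra.
Variables (F : fieldType) (B : algType F).
Implicit Types f g : fps B.

Lemma fps_coefZ (c : F) f n : (c *: f) n = c *: f n. Proof. by []. Qed.

Lemma fps_coef_powerseries m (c : nat -> F) f N n : f 0%N = 0 -> (n < N)%N ->
  fps_series m (fun k => c k *: f ^+ k) n = \sum_(m <= k < N) c k *: (f ^+ k) n.
Proof.
move=> f0 nN; rewrite (@fps_seriesE _ _ _ N) // => k Nk.
by rewrite fps_coefZ fps_coefX_lt ?scaler0 // (leq_trans nN).
Qed.

Lemma fps_powerseries_CT m (c : nat -> F) (b : B) n : (m <= n)%N ->
  fps_series m (fun k => c k *: (fpsC b * fpsT) ^+ k) n = c n *: b ^+ n.
Proof.
have X k : (fpsC b * fpsT) ^+ k = fpsC (b ^+ k) * fpsT ^+ k.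
  by rewrite exprMn_comm ?fpsCX //; apply: fpsCT_comm.
move=> mn; rewrite (@fps_series_single _ _ _ _ n) // => [|j jn].
  by rewrite fps_coefZ X fps_coefCM fps_coefTX eqxx mulr1.
by rewrite fps_coefZ X fps_coefCM fps_coefTX eq_sym (negPf jn) mulr0 scaler0.
Qed.

Lemma fps_exp0 f : f 0%N = 0 -> fps_exp f 0%N = 1.
Proof.
move=> f0; rewrite (@fps_coef_powerseries _ _ _ 1) //.
by rewrite big_nat1 expr0 invr1 scale1r.
Qed.

(** In degree n+1 the factor is (1 - q^(n+1)) / [n+1]_q = 1 - q. On Jackson's sum, the difference
    telescopes to the term k = 0. *)
Lemma qint_sub_dil (q : F) f : (forall n, qnum q n.+1 != 0) ->
  qint q f - qdil q (qint q f) = (1 - q) *: (fpsT * f).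
Proof.
move=> q0; have q1 : 1 - q != 0.
  (* If 1 - q were 0, then [qnum q 1] would be 0 by the convention 1/0 = 0. *)
  by apply: contra_neq (q0 0%N) => e; rewrite /qnum e invr0 mulr0.
apply: fpsP => -[|n]; rewrite fps_coefD fps_coefN fps_coefZ.
  by rewrite fps_coefTM0 /= !scaler0 subr0.
rewrite fps_coefTM /= scalerA -scalerBl; congr (_ *: _).
rewrite -{1}[_^-1]mul1r -mulrBl /qnum invf_div mulrCA mulfV ?mulr1 //.
by have := q0 n; rewrite /qnum mulf_eq0 negb_or => /andP[].
Qed.

Lemma qdilM (q : F) f g : qdil q (f * g) = qdil q f * qdil q g.
Proof.
apply: fpsP => n; rewrite /= /fps_mul scaler_sumr; apply: eq_bigr => i _ /=.
by rewrite -scalerAl -scalerAr scalerA -exprD subnKC // -ltnS.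
Qed.

End Algebra.

(** Turns the recursions for the coefficients of both q-exponentials into closed forms. *)
Lemma qnum_div_qfact (F : fieldType) (q x : F) n : qnum q n.+1 != 0 ->
  qnum q n.+1 * (x / qfact q n.+1) = x / qfact q n.
Proof.
move=> qn0; rewrite /qfact [in LHS]big_nat_recr //= invfM.
by rewrite mulrCA [_^-1 * _^-1]mulrC mulVKf.
Qed.

(** * The exponential as the solution of g' = f' g in characteristic zero *)

Section Exponential.
Variables (F : fieldType) (B : algType F).
Hypothesis F_char0 : [pchar F] =i pred0.
Hypothesis mulBC : commutative (@GRing.mul B).
Implicit Types f g h : fps B.

Let natrS_neq0 n : n.+1%:R != 0 :> F.
Proof. by have /pcharf0P -> := F_char0. Qed.

Lemma mulrnS_inj n : injective (fun x : B => x *+ n.+1).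
Proof.
by move=> x y /= xy; apply: (scalerI (natrS_neq0 n)); rewrite !scaler_nat.
Qed.

(** The truncations [P] satisfy P(N+1)' = f' P(N) exactly, since (f^k / k!)' = f' f^(k-1) / (k-1)!;
    each coefficient sees only a truncation. *)
Lemma fps_exp_deriv f : f 0%N = 0 ->
  fps_deriv (fps_exp f) = fps_deriv f * fps_exp f.
Proof.
move=> f0; apply: fpsP => n.
pose P N : fps B := \sum_(0 <= k < N) (k`!%:R)^-1 *: f ^+ k.
have expP N i : (i < N)%N -> fps_exp f i = P N i.
  by move=> iN; rewrite fps_coef_sum; apply: fps_coef_powerseries.
rewrite (@fps_coefM_eqr _ _ _ (P n.+1)) => [|i i_n]; last exact: expP.
rewrite -[LHS]/(fps_exp f n.+1 *+ n.+1) (expP n.+2) //.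
suff -> : fps_deriv f * P n.+1 = fps_deriv (P n.+2) by [].
elim: (n.+1) => [|N IHN].
  rewrite /P big_nat1 big_geq // mulr0 expr0 invr1 scale1r.
  by apply: fpsP => i /=; rewrite mul0rn.
rewrite [P N.+1]big_nat_recr // [P N.+2]big_nat_recr //= mulrDr IHN.
rewrite fps_derivD; congr (_ + _).
have -> : fps_deriv ((N.+1)`!%:R^-1 *: f ^+ N.+1) =
    (N.+1)`!%:R^-1 *: fps_deriv (f ^+ N.+1).
  by apply: fpsP => i; rewrite /= scalerMnr.
rewrite (fps_derivX mulBC) -scaler_nat scalerA -scalerAr; congr (_ *: _).
rewrite factS natrM invfM mulrAC mulVf ?mul1r //.
Qed.

(** The equation expresses (n+1) f_(n+1) through f_0, ..., f_n, and n+1 can be cancelled in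
    characteristic zero. *)
Lemma fps_ode_uniq h f g : fps_deriv f = h * f -> fps_deriv g = h * g ->
  f 0%N = g 0%N -> f = g.
Proof.
move=> fE gE fg0; apply: fpsP; elim/ltn_ind => -[//|n] IHn.
apply: (@mulrnS_inj n).
have /= -> := congr1 (fun u : fps B => u n) fE.
have /= -> := congr1 (fun u : fps B => u n) gE.
by apply: fps_coefM_eqr => i i_n; apply: IHn.
Qed.

Lemma fps_exp_unique f g : f 0%N = 0 -> g 0%N = 1 ->
  fps_deriv g = fps_deriv f * g -> fps_exp f = g.
Proof.
move=> f0 g0 gE; apply: fps_ode_uniq (fps_exp_deriv f0) gE _.
by rewrite fps_exp0.
Qed.

Lemma fps_expD f g : f 0%N = 0 -> g 0%N = 0 ->
  fps_exp (f + g) = fps_exp f * fps_exp g.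
Proof.
(* The two exponentials are abstracted to [u] and [v]: only their constant terms and differential
   equations matter. *)
have expD (u v : fps B) : f 0%N = 0 -> g 0%N = 0 -> u 0%N = 1 -> v 0%N = 1 ->
    fps_deriv u = fps_deriv f * u -> fps_deriv v = fps_deriv g * v ->
    fps_exp (f + g) = u * v.
  move=> f0 g0 u0 v0 uE vE; apply: fps_exp_unique.
  - by rewrite fps_coefD f0 g0 addr0.
  - by rewrite fps_coefM0 u0 v0 mulr1.
  rewrite fps_derivM fps_derivD uE vE mulrDl -mulrA; congr (_ + _).
  by rewrite !mulrA [u * _](fps_mulC mulBC).
by move=> f0 g0; apply: expD; rewrite ?fps_exp0 //; apply: fps_exp_deriv.
Qed.

(** By the chain rule (g(qt))' = q g'(qt), both sides solve the same differential equation. *)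
Lemma fps_exp_dil (q : F) f : f 0%N = 0 ->
  fps_exp (qdil q f) = qdil q (fps_exp f).
Proof.
have derivM g : fps_deriv (qdil q g) = q *: qdil q (fps_deriv g).
  by apply: fpsP => n; rewrite /= scalerA -exprS scalerMnr.
move=> f0; apply: fps_exp_unique.
- by rewrite /= f0 scaler0.
- by rewrite /= -[RHS](fps_exp0 f0) scale1r.
by rewrite !derivM fps_exp_deriv // qdilM scalerAl.
Qed.

End Exponential.

(** * The case a = 1 over a commutative algebra *)

Section Scalar.
Variables (F : fieldType) (B : algType F) (q : F).
Hypothesis F_char0 : [pchar F] =i pred0.
Hypothesis mulBC : commutative (@GRing.mul B).
Hypothesis q0 : forall n, qnum q n.+1 != 0.

Let q1 : 1 - q != 0.
Proof. by apply: contra_neq (q0 0%N) => e; rewrite /qnum e invr0 mulr0. Qed.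

(** Exponentiates W = (1 - q) t f + M_q W for W = I_q f. *)
Lemma fps_exp_qint (f : fps B) : fps_exp (qint q f) =
  fps_exp ((1 - q) *: (fpsT * f)) * qdil q (fps_exp (qint q f)).
Proof.
set W := qint q f; set u := _ *: _.
have W0 : W 0%N = 0 by [].
have u0 : u 0%N = 0 by rewrite fps_coefZ fps_coefTM0 scaler0.
have dW0 : qdil q W 0%N = 0 by rewrite /= scaler0.
have WE : W = u + qdil q W by rewrite /u -qint_sub_dil // subrK.
apply: etrans (congr1 (@fps_exp F B) WE) _.
apply: etrans (fps_expD F_char0 mulBC u0 dW0) _.
by congr (_ * _); apply: fps_exp_dil.
Qed.

(** Same relation, rearranged as M_q(-W) = (1 - q) t f - W so that no inverse of an exponential is
    needed. *)
Lemma fps_exp_qintN (f : fps B) : qdil q (fps_exp (- qint q f)) =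
  fps_exp ((1 - q) *: (fpsT * f)) * fps_exp (- qint q f).
Proof.
set W := qint q f; set u := _ *: _.
have W0 : (- W) 0%N = 0 by rewrite fps_coefN oppr0.
have u0 : u 0%N = 0 by rewrite fps_coefZ fps_coefTM0 scaler0.
have WE : qdil q (- W) = u + - W.
  rewrite /u -qint_sub_dil // -/W [_ - _ - _]addrAC subrr add0r.
  by apply: fpsP => n /=; rewrite scalerN.
apply: etrans (esym (fps_exp_dil F_char0 mulBC q W0)) _.
apply: etrans (congr1 (@fps_exp F B) WE) _.
exact: fps_expD.
Qed.

(** The shift to [n.+1] encodes the factor t and discards the constant term 1 of the exponential. *)
Lemma Wq_exp (f : fps B) n :
  (1 - q) *: Wq q f n = fps_exp ((1 - q) *: (fpsT * f)) n.+1.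
Proof.
set u := (1 - q) *: (fpsT * f).
have u0 : u 0%N = 0 by rewrite fps_coefZ fps_coefTM0 scaler0.
have preE g : qprelie q f g = u * g.
  by rewrite /qprelie [g * _](fps_mulC mulBC) -mulrBl qint_sub_dil.
rewrite WqE (@fps_coef_powerseries _ _ _ _ _ n.+2) // [RHS]big_nat_recl //.
rewrite expr0 fps_coef1 scaler0 add0r scaler_sumr; apply: eq_bigr => k _.
(* Left pre-Lie multiplication by f is multiplication by u. One more factor u = (1 - q) t f then
   absorbs the last f. *)
have -> : iter k (qprelie q f) f = u ^+ k * f.
  elim: k => [|k IHk]; first by rewrite mul1r.
  by rewrite iterS IHk preE exprS mulrA.
rewrite scalerA mulrC -scalerA; congr (_ *: _).
rewrite exprSr -scalerAr mulrA [_ * fpsT](fps_mulC mulBC) -mulrA.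
by rewrite fps_coefZ fps_coefTM.
Qed.

(** The expansion of log(1 + (1 - q) t) / ((1 - q) t), the candidate for Omega'_q(1). *)
Definition omega1 : fps B := FPS (fun n => ((q - 1) ^+ n / n.+1%:R)%:A).

(** The exponent u has the geometric derivative u' = (1 - q) / (1 + (1 - q) t), so the right-hand
    side solves g' = u' g. *)
Lemma fps_exp_omega1 :
  fps_exp ((1 - q) *: (fpsT * omega1)) = 1 + (1 - q) *: fpsT.
Proof.
apply: (fps_exp_unique F_char0 mulBC).
- by rewrite fps_coefZ fps_coefTM0 scaler0.
- by rewrite fps_coefD fps_coefZ /= scaler0 addr0.
rewrite mulrDr mulr1 -scalerAr [_ * fpsT](fps_mulC mulBC).
have dE n : fps_deriv ((1 - q) *: (fpsT * omega1)) n =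
    ((1 - q) * (q - 1) ^+ n)%:A.
  rewrite -[LHS]/(((1 - q) *: (fpsT * omega1)) n.+1 *+ n.+1).
  rewrite fps_coefZ fps_coefTM /=.
  rewrite scalerA -scaler_nat scalerA; congr (_ *: _).
  by rewrite [LHS]mulrC -!mulrA mulVf ?mulr1 //; have /pcharf0P -> := F_char0.
apply: fpsP => -[|n]; rewrite fps_coefD fps_coefZ dE.
  by rewrite fps_coefTM0 scaler0 addr0 /= add0r mulr1n mulr1.
(* In positive degree, consecutive terms of the geometric series cancel against the factor 1 + (1 -
   q) t. *)
rewrite fps_coefTM dE /= add0r scaler0 mul0rn scalerA -scalerDl.
by rewrite exprS -[q - 1]opprB !mulNr mulrN addNr scale0r.
Qed.

Lemma Wq_omega1 : Wq q omega1 = 1.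
Proof.
apply: fpsP => n; apply: (scalerI q1).
rewrite Wq_exp fps_exp_omega1 fps_coefD fps_coef1 add0r fps_coefZ /=.
by case: n.
Qed.

(** The coefficient of t^(n+1) in G(t) = (1 + (1 - q) t) G(qt) gives [n+1]_q G_(n+1) = q^n G_n. *)
Lemma fps_exp_Omega1 n :
  fps_exp (qint q omega1) n = (q ^+ (n * n.-1)./2 / qfact q n)%:A.
Proof.
set G := fps_exp _.
have GE : G = (1 + (1 - q) *: fpsT) * qdil q G.
  by rewrite -fps_exp_omega1; apply: fps_exp_qint.
elim: n => [|n IHn].
  by rewrite /G fps_exp0 // /qfact big_geq // divr1 scale1r.
apply: (scalerI (q0 n)); transitivity (q ^+ n *: G n); last first.
  rewrite IHn !scalerA; congr (_ *: _).
  (* The exponents n(n-1)/2 are binomials C(n, 2), so adding n is Pascal's rule. *)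
  by rewrite qnum_div_qfact // mulrA -exprD -!bin2 binS bin1 addnC.
have := congr1 (fun u : fps B => u n.+1) GE.
rewrite mulrDl mul1r -scalerAl fps_coefD fps_coefZ fps_coefTM /= => e.
apply: (scalerI q1); rewrite scalerA [_ * qnum _ _]mulrC /qnum divfK //.
by rewrite scalerBl scale1r {1}e [X in X - _]addrC addrK.
Qed.

(** Here H(qt) = (1 + (1 - q) t) H(t) gives [n+1]_q H_(n+1) = - H_n. *)
Lemma fps_exp_OmegaN1 n :
  fps_exp (- qint q omega1) n = ((-1) ^+ n / qfact q n)%:A.
Proof.
set H := fps_exp _.
have HE : qdil q H = (1 + (1 - q) *: fpsT) * H.
  by rewrite -fps_exp_omega1; apply: fps_exp_qintN.
elim: n => [|n IHn].
  by rewrite /H fps_exp0 ?fps_coefN ?oppr0 // /qfact big_geq // divr1 scale1r.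
apply: (scalerI (q0 n)); transitivity (- H n); last first.
  rewrite IHn scalerA -scaleNr; congr (_ *: _).
  by rewrite qnum_div_qfact // exprS mulN1r mulNr.
have := congr1 (fun u : fps B => u n.+1) HE.
rewrite mulrDl mul1r -scalerAl fps_coefD fps_coefZ fps_coefTM /= => e.
apply: (scalerI q1); rewrite scalerA [_ * qnum _ _]mulrC /qnum divfK //.
by rewrite scalerBl scale1r e opprD addNKr scalerN.
Qed.

End Scalar.

(** * The substitution t -> a t from F[[t]] to B[[t]] *)

Section Rescale.
Variables (F : fieldType) (B : algType F) (a : B).
Implicit Types f g : fps F^o.

(** Multiplicative even for noncommutative B, since only powers of the single element a occur. *)
Definition rescale f : fps B := FPS (fun n => (f n : F) *: a ^+ n).

Lemma rescaleM f g : rescale (f * g) = rescale f * rescale g.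
Proof.
apply: fpsP => n; rewrite /= /fps_mul scaler_suml; apply: eq_bigr => i _ /=.
by rewrite -scalerAl -scalerAr scalerA -exprD subnKC // -ltnS.
Qed.

Lemma rescale1 : rescale 1 = 1.
Proof. by apply: fpsP => -[|n]; rewrite /= ?scale1r ?scale0r. Qed.

Lemma rescaleB f g : rescale (f - g) = rescale f - rescale g.
Proof. by apply: fpsP => n; rewrite /= scalerBl. Qed.

Lemma rescaleN f : rescale (- f) = - rescale f.
Proof. by apply: fpsP => n; rewrite /= scaleNr. Qed.

Lemma rescaleX f k : rescale (f ^+ k) = rescale f ^+ k.
Proof. by elim: k => [|k IHk]; rewrite ?rescale1 // !exprS rescaleM IHk. Qed.

Lemma rescale_dil q f : rescale (qdil q f) = qdil q (rescale f).
Proof. by apply: fpsP => n; rewrite /= scalerA. Qed.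

Lemma rescaleC_comm f : GRing.comm (rescale f) (fpsC a).
Proof.
apply: fpsP => n; rewrite fps_coefMC fps_coefCM /=.
by rewrite -scalerAl -scalerAr -exprS -exprSr.
Qed.

Lemma rescale_exp f : f 0%N = 0 -> fps_exp (rescale f) = rescale (fps_exp f).
Proof.
move=> f0; apply: fpsP => n; rewrite -[RHS]/((fps_exp f n : F) *: a ^+ n).
have rf0 : rescale f 0%N = 0 by rewrite /= f0 scale0r.
have -> := fps_coef_powerseries 0 (fun k => k`!%:R^-1) f0 (ltnSn n).
rewrite (fps_coef_powerseries _ _ rf0 (ltnSn n)) scaler_suml.
by apply: eq_bigr => k _; rewrite -rescaleX /= scalerA.
Qed.

(** I_q raises the degree in t by one; the extra factor a supplies the missing power. *)
Lemma qint_rescale q f : qint q (rescale f * fpsC a) = rescale (qint q f).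
Proof.
apply: fpsP => -[|n]; first by rewrite /= scale0r.
rewrite -[LHS]/((qnum q n.+1)^-1 *: (rescale f * fpsC a) n) fps_coefMC /=.
by rewrite -scalerAl -exprSr scalerA.
Qed.

(** Writing r for [rescale a], the pre-Lie product of r(f) a and r(g) a is r(f |>_q g) a, so the
    shape r(f) a survives every iteration. *)
Lemma Wq_rescale q f : Wq q (rescale f * fpsC a) = rescale (Wq q f) * fpsC a.
Proof.
have itE k : iter k (qprelie q (rescale f * fpsC a)) (rescale f * fpsC a) =
    rescale (iter k (qprelie q f) f) * fpsC a.
  elim: k => //= k ->; rewrite {1}/qprelie qint_rescale -rescale_dil.
  rewrite rescaleB !rescaleM mulrBl !mulrA; congr (_ - _).
  (* In the second product, a must be moved to the right past the rescaled dilation. *)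
  by rewrite -!mulrA rescaleC_comm.
apply: fpsP => n; rewrite fps_coefMC WqE.
rewrite -[rescale _ n]/((Wq q f n : F) *: a ^+ n) WqE scaler_suml mulr_suml.
apply: eq_bigr => k _; rewrite itE fps_coefMC /=.
by rewrite !scalerAl scalerA.
Qed.

End Rescale.

(** * Transfer to an arbitrary element a, and closed forms *)

Section Omega.
Variables (F : fieldType) (q : F).
Hypothesis F_char0 : [pchar F] =i pred0.
Hypothesis q0 : forall n, qnum q n.+1 != 0.
Variables (B : algType F) (a : B).

(** As W_q is injective, it suffices that W_q sends the right-hand side to a. *)
Lemma Omega'qC : Omega'q q (fpsC a) = rescale a (omega1 F^o q) * fpsC a.
Proof.
apply: (bij_inj (Wq_bij B q)); rewrite Omega'qK Wq_rescale.
by rewrite (Wq_omega1 F_char0 (@mulrC F^o) q0) rescale1 mul1r.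
Qed.

Lemma Omega'q_coef n :
  Omega'q q (fpsC a) n = ((q - 1) ^+ n / n.+1%:R) *: a ^+ n.+1.
Proof. by rewrite Omega'qC fps_coefMC /= -scalerAl -exprSr [_%:A]mulr1. Qed.

Lemma OmegaqC : Omegaq q (fpsC a) = rescale a (qint q (omega1 F^o q)).
Proof. by rewrite /Omegaq Omega'qC qint_rescale. Qed.

Lemma fps_exp_OmegaqC :
  fps_exp (Omegaq q (fpsC a)) = qExp q (fpsC a * fpsT).
Proof.
apply: etrans (congr1 (@fps_exp F B) OmegaqC) _.
apply: etrans (rescale_exp a _) _ => //; apply: fpsP => n.
rewrite -[LHS]/((fps_exp (qint q (omega1 F^o q)) n : F) *: a ^+ n).
rewrite (fps_exp_Omega1 F_char0 (@mulrC F^o) q0) [_%:A]mulr1.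
by rewrite /qExp fps_powerseries_CT.
Qed.

Lemma Omega'q_monomials : Omega'q q (fpsC a) =
  fps_series 1 (fun n => (q - 1) ^+ n.-1 *:
                           ((n%:R^-1 *: fpsT ^+ n.-1) * fpsC (a ^+ n))).
Proof.
apply: fpsP => n; rewrite (@fps_series_single _ _ _ _ n.+1) // => [|k kn].
  rewrite fps_coefZ fps_coefMC fps_coefZ fps_coefTX eqxx.
  by rewrite -scalerAl mul1r scalerA Omega'q_coef.
rewrite fps_coefZ fps_coefMC fps_coefZ fps_coefTX.
(* At index 0 the truncated exponent [k.-1] is 0 too, so the monomial may not vanish in degree n;
   the convention 1/0 = 0 kills the term. *)
case: k kn => [|k] kn; first by rewrite invr0 scale0r mul0r scaler0.
by rewrite eq_sym -eqSS (negPf kn) scaler0 mul0r scaler0.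
Qed.

Lemma Omegaq_monomials : Omegaq q (fpsC a) =
  fps_series 1 (fun n => ((q - 1) ^+ n.-1 / qnum q n) *:
                           ((n%:R^-1 *: fpsT ^+ n) * fpsC (a ^+ n))).
Proof.
have coefE n k : (((q - 1) ^+ k.-1 / qnum q k) *:
    ((k%:R^-1 *: fpsT ^+ k) * fpsC (a ^+ k)) : fps B) n =
    if n == k then ((q - 1) ^+ k.-1 / qnum q k / k%:R) *: a ^+ k else 0.
  rewrite fps_coefZ fps_coefMC fps_coefZ fps_coefTX -scalerAl scalerA.
  by case: eqP => _; rewrite ?mul1r // mul0r scaler0.
apply: fpsP => -[|n].
  (* Degree 0 has no matching index, as the sum starts at 1. *)
  rewrite (@fps_seriesE _ _ _ 1) ?big_geq // => -[//|k] _.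
  by rewrite coefE.
rewrite (@fps_series_single _ _ _ _ n.+1) // => [|k kn]; last first.
  by rewrite coefE eq_sym (negPf kn).
rewrite coefE eqxx -[LHS]/((qnum q n.+1)^-1 *: Omega'q q (fpsC a) n).
by rewrite Omega'q_coef scalerA mulrC mulrAC.
Qed.

Lemma Omega'q_log : Omega'q q (fpsC a) =
  - ((q - 1)^-1 *: fps_divT (fps_log (1 - (q - 1) *: (fpsC a * fpsT)))).
Proof.
have xE : 1 - (q - 1) *: (fpsC a * fpsT) - 1 = fpsC (- (q - 1) *: a) * fpsT.
  rewrite addrAC subrr add0r -scaleNr scalerAl; congr (_ * _).
  by apply: fpsP => -[|n] //=; rewrite scaler0.
apply: fpsP => n; rewrite fps_coefN fps_coefZ.
rewrite -[fps_divT _ n]/(fps_log _ n.+1) /fps_log xE fps_powerseries_CT //.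
rewrite Omega'q_coef exprZn !scalerA -scaleNr; congr (_ *: _).
have q1 : q - 1 != 0.
  apply: contra_neq (q0 0%N) => /eqP; rewrite subr_eq0 => /eqP ->.
  by rewrite /qnum subrr invr0 mulr0.
(* With x = -(q - 1), the sign (-1)^n of the logarithm turns x^(n+1) into x (q - 1)^n, and x cancels
   against -(q - 1)^-1. *)
rewrite [LHS]mulrC -{1}[q - 1]opprK [(- - _) ^+ n]exprNn exprS /=.
rewrite mulNr mulrN opprK [(q - 1)^-1 * _]mulrC -[RHS]mulrA mulKf //.
by rewrite [RHS]mulrAC [LHS]mulrC.
Qed.

End Omega.

(** Substituting t -> -a t contributes (-1)^n, which cancels the sign in the coefficients of
    exp(-Omega_q(1)). *)
Lemma fps_exp_OmegaqCN (F : fieldType) (q : F) :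
  [pchar F] =i pred0 -> (forall n, qnum q n.+1 != 0) ->
  forall (B : algType F) (a : B),
  fps_exp (- Omegaq q (- fpsC a)) = qexp q (fpsC a * fpsT).
Proof.
move=> F0 q0 B a; have -> : - fpsC a = fpsC (- a).
  by apply: fpsP => -[|n] //=; rewrite oppr0.
have OE : - Omegaq q (fpsC (- a)) = rescale (- a) (- qint q (omega1 F^o q)).
  by rewrite OmegaqC // rescaleN.
apply: etrans (congr1 (@fps_exp F B) OE) _.
apply: etrans (rescale_exp _ _) _; first by rewrite fps_coefN oppr0.
apply: fpsP => n.
rewrite -[LHS]/((fps_exp (- qint q (omega1 F^o q)) n : F) *: (- a) ^+ n).
rewrite (fps_exp_OmegaN1 F0 (@mulrC F^o) q0) [_%:A]mulr1.
rewrite /qexp fps_powerseries_CT // -[- a]scaleN1r exprZn scalerA.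
by rewrite mulrAC -exprMn mulrNN mulr1 expr1n mul1r.
Qed.

Theorem proposition11 (R : realType) (q : R) (hq : 0 < q < 1)
    (B : algType R[i]) (a : B) :
  let p : R[i] := q%:C in
  [/\ fps_exp (Omegaq p (fpsC a)) = qExp p (fpsC a * fpsT),
      fps_exp (- Omegaq p (- fpsC a)) = qexp p (fpsC a * fpsT),
      Omegaq p (fpsC a) =
        fps_series 1 (fun n => ((p - 1) ^+ n.-1 / qnum p n) *:
                                 ((n%:R^-1 *: fpsT ^+ n) * fpsC (a ^+ n))),
      Omega'q p (fpsC a) =
        fps_series 1 (fun n => (p - 1) ^+ n.-1 *:
                                 ((n%:R^-1 *: fpsT ^+ n.-1) * fpsC (a ^+ n)))
    & Omega'q p (fpsC a) =
        - ((p - 1)^-1 *: fps_divT (fps_log (1 - (p - 1) *: (fpsC a * fpsT))))].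
Proof.
move=> p; have /andP[q_gt0 q_lt1] := hq.
(* Since 0 < q < 1, no positive power of q is 1, and the embedding of R into R[i] is injective. *)
have p0 n : qnum p n.+1 != 0.
  have X_neq1 k : 1 - p ^+ k.+1 != 0.
    rewrite subr_eq0 eq_sym /p -rmorphXn (inj_eq (@complexI _)).
    rewrite Order.POrderTheory.lt_eqF // Num.Theory.exprn_ilt1 //.
    exact: Order.POrderTheory.ltW.
  by rewrite /qnum mulf_neq0 ?invr_eq0 // -[p]expr1.
have F0 : [pchar R[i]] =i pred0 by exact: Num.Theory.pchar_num.
split; [exact: fps_exp_OmegaqC | exact: fps_exp_OmegaqCN |
  exact: Omegaq_monomials | exact: Omega'q_monomials | exact: Omega'q_log].
Qed.
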